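(* Let $p$ be an odd prime, $q=p^3$, and let $G=\langle a,b\rangle\le\mathfrak{S}_q$ be the group described in the context. Let $f$ be a permutation group polynomial over $\mathbb{F}_q$ corresponding to $G$, and let $\mathcal{P}_f$ be the number of permutation group polynomials over $\mathbb{F}_q$ of the same form as $f$. Then $$\mathcal{P}_{f}=\dfrac{(p^3!)^2}{p^3(p^4-p^3)}.$$
   Context: $\mathfrak{S}_q$ is the symmetric group on $\mathbb{F}_q=\{c_0,\ldots,c_{q-1}\}$ (a fixed enumeration); permutations are composed right to left. The permutations are $$a=(c_{0},c_{1},\ldots,c_{p^2-1})(c_{p^2},\ldots,c_{2p^2-1})\cdots (c_{p^2(p-1)},\ldots,c_{p^3-1}),\qquad b=b_{0}\,b_{1}^{1+p}\,b_2^{1+2p}\cdots b_{p-1}^{1+(p-1)p},$$ where $b_{k}=(c_{k},c_{p^2+k},\ldots,c_{(p-1)p^2+k},\;c_{p+k},c_{p+p^2+k},\ldots,c_{p+(p-1)p^2+k},\;\ldots,\;c_{(p-1)p+k},c_{(p-1)p+p^2+k},\ldots,c_{(p-1)p+(p-1)p^2+k})$ is a $p^2$-cycle (entries $c_{jp+ip^2+k}$, with $i=0,\ldots,p-1$ running first for $j=0$, then $j=1$, etc.). The group $G=\langle a,b\rangle$ has order $q$ and no non-identity element of $G$ has a fixed point. Functions $\mathbb{F}_q^2\to\mathbb{F}_q$ are identified with polynomials in $\mathbb{F}_q[X_1,X_2]$ of degree less than $q$ in each variable (these are the polynomials being counted). A bivariate polynomial $f$ is a local permutation polynomial (LPP)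 if for every $c\in\mathbb{F}_q$ both $x\mapsto f(x,c)$ and $x\mapsto f(c,x)$ are bijections of $\mathbb{F}_q$. Bivariate LPPs are in bijection with permutation polynomial tuples, i.e. tuples $\underline{\beta}_f=(\beta_0,\ldots,\beta_{q-1})\in\mathfrak{S}_q^q$ such that $\beta_i\beta_j^{-1}$ has no fixed point for $i\ne j$, via $f(x,\beta_i(x))=c_i$ for all $x\in\mathbb{F}_q$ and all $i$. An LPP is a permutation group polynomial if the entries of its tuple form a subgroup of $\mathfrak{S}_q$, and it then corresponds to that subgroup. Two permutation group polynomials over $\mathbb{F}_q$ are of the same form if their corresponding subgroups of $\mathfrak{S}_q$ are isomorphic as groups. *)

(* Defs.v *)
From HB Require Import structures.
From mathcomp Require Export all_boot all_order all_algebra all_fingroup.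
From mathcomp Require Export mpoly.

Set Implicit Arguments.
Unset Strict Implicit.
Unset Printing Implicit Defensive.

Import GRing.Theory.
Local Open Scope ring_scope.

(* The product of {perm F} composes left to right, whereas the source composes
   right to left.  The products below only involve disjoint (hence commuting)
   cycles, a set of permutations is a subgroup for one convention iff it is for
   the other, and inversion identifies the two group structures, so neither the
   subgroups nor their isomorphism types depend on the choice. *)

(* The cycle (s_0, s_1, ..., s_(n-1)); undup is the identity on the
   duplicate-free sequences for which this is used. *)
Definition cycle_perm (T : finType) (s : seq T) : {perm T} :=
  perm (can_inj (prev_next (undup_uniq s))).

Section Generators.
Variables (F : finFieldType) (p : nat) (c : seq F).

Definition cycle_a (m : nat) : {perm F} :=
  cycle_perm [seq c`_(m * p ^ 2 + j) | j <- iota 0 (p ^ 2)].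

Definition perm_a : {perm F} := (\prod_(m < p) cycle_a m)%g.

Definition cycle_b (k : nat) : {perm F} :=
  cycle_perm [seq c`_(j * p + i * p ^ 2 + k) | j <- iota 0 p, i <- iota 0 p].

Definition perm_b : {perm F} :=
  (\prod_(k < p) cycle_b k ^+ (1 + k * p))%g.

Definition groupG : {group {perm F}} := <<[set perm_a; perm_b]>>%G.
End Generators.

Section LocalPermutationPolynomials.
Variable F : finFieldType.
Implicit Types f g : {mpoly F[2]}.

Definition eval2 f (x y : F) : F := f.@[tnth [tuple x; y]].

Definition reduced f : Prop :=
  forall m : 'X_{1..2}, m \in msupp f -> forall i : 'I_2, (m i < #|F|)%N.

(* Polynomials stand for functions F^2 -> F, so only reduced ones are allowed. *)
Definition lpp f : Prop :=
  reduced f /\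
  forall z : F, bijective (fun x => eval2 f x z) /\ bijective (eval2 f z).

Section Enumeration.
Variables (q : nat) (c : q.-tuple F).

(* f(x, beta_i(x)) = c_i: for an LPP f this determines beta. *)
Definition perm_tuple_of f (beta : 'I_q -> {perm F}) : Prop :=
  forall (i : 'I_q) (x : F), eval2 f x (beta i x) = tnth c i.

Definition corresponds_to f (H : {group {perm F}}) : Prop :=
  lpp f /\
  exists2 beta : 'I_q -> {perm F},
    perm_tuple_of f beta & [set beta i | i : 'I_q] = H :> {set {perm F}}.

Definition perm_group_poly f : Prop := exists H, corresponds_to f H.

Definition same_form f g : Prop :=
  exists H K : {group {perm F}},
    [/\ corresponds_to f H, corresponds_to g K & (H \isog K)%g].
End Enumeration.
End LocalPermutationPolynomials.

Definition has_card (T : eqType) (P : T -> Prop) (n : nat) : Prop :=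
  exists s : seq T, [/\ uniq s, forall x, x \in s <-> P x & size s = n].

(* Main.v *)
(** A permutation group polynomial is the same datum as an enumeration
    (beta_i) of a regular subgroup of the symmetric group: the LPP condition
    says exactly that for all x, y there is a unique i with beta_i(x) = y, and
    interpolation recovers the reduced polynomial from the tuple. A regular
    subgroup isomorphic to G is conjugate to G, and the normalizer of G is its
    holomorph, of order q |Aut G|, because an automorphism of a regular group
    together with the image of one point determines, uniquely, a permutation
    inducing it by conjugation. Hence the count is q! * q! / (q |Aut G|).
    Here G has order p^3 (as f exists), is not abelian and contains the element
    a of order p^2, so it is the modular group, generated by x of order p^2 and
    y of order p with x^y = x^(1+p). Its automorphisms correspond to the pairs
    (x', y') satisfying the same relations: x' is any of the p^3 - p^2 elements
    outside Omega_1(G), and then there are p choices of y' in Omega_1(G). *)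

Require Import Defs.
From mathcomp Require Import all_solvable zify.
Set Implicit Arguments.
Unset Strict Implicit.
Unset Printing Implicit Defensive.
Import GroupScope GRing.Theory.

(** * The modular group of order p^3 and its automorphisms *)

Lemma conj_expg (gT : finGroupType) (x y : gT) k j :
  x ^ y = x ^+ k -> x ^ (y ^+ j) = x ^+ (k ^ j).
Proof.
by move=> xy; elim: j => [|j IHj]; rewrite ?conjg1 // expgSr conjgM IHj conjXg xy -expgM expnS.
Qed.

Section ModularAut.
Variables (p : nat) (gT : finGroupType) (G : {group gT}).
Hypotheses (p_pr : prime p) (p_odd : odd p) (isoG : G \isog 'Mod_(p ^ 3)).

Let p_gt1 : (1 < p)%N := prime_gt1 p_pr.

Lemma card_modular_p3 : #|G| = (p ^ 3)%N.
Proof. by rewrite (card_isog isoG) card_modular_group. Qed.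

Let pG : p.-group G.
Proof. by rewrite /pgroup card_modular_p3 pnatX pnat_id. Qed.

Lemma modular_p3_structure :
  exists x y, [/\ x \in G, y \in G, #[x] = (p ^ 2)%N, #[y] = p &
   [/\ x ^ y = x ^+ p.+1, <[x]> ><| <[y]> = G, ~~ abelian G,
    #|'Z(G)| = p &
   [/\ 'Z(G) = G^`(1), 'Mho^1(G) = 'Z(G) & #|'Ohm_1(G)| = (p ^ 2)%N]]].
Proof.
have [[x y] gen mod] := generators_modular_group p_pr (isT : 2 < 3) isoG.
have [[defG nab _] [defZ _ oZ] [dG1 _ _] Mh Oh] :=
  modular_group_structure p_pr (isT : 2 < 3) gen isoG mod.
have [_ Gx ox /setDP [Gy _]] := gen; have [oy xy] := mod.
rewrite /= expn1 in xy dG1 oZ.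
(* Oddness excludes the dihedral group of order 8, whose Omega_1 is the whole group. *)
have p_n2 : ((p, 3) == (2, 3)) = false.
  by apply/negP => /eqP [] p2; move: p_odd; rewrite p2.
rewrite p_n2 in Oh; have [_ oO] := Oh 1%N isT.
exists x, y; split=> //; split=> //; split=> //; first by rewrite dG1 defZ.
by rewrite Mh // expn1 defZ.
Qed.

(** Omega_1(G) has order p^2, hence is abelian, so products of elements killed by p are still killed
    by p. *)
Lemma Ohm1_modular_p3 : 'Ohm_1(G) = 'Ldiv_p(G).
Proof.
have [_ [_ [_ _ _ _ [_ _ _ _ [_ _ oO]]]]] := modular_p3_structure.
rewrite (OhmEabelian (n := 1) pG) ?expn1 //.
exact: card_p2group_abelian p_pr oO.
Qed.

(** An element of order p^3 would make G cyclic, and one of order at most p lies in Omega_1(G). *)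
Lemma order_notin_Ohm1 x : x \in G -> x \notin 'Ohm_1(G) -> #[x] = (p ^ 2)%N.
Proof.
have [_ [_ [_ _ _ _ [_ _ nab _ _]]]] := modular_p3_structure.
move=> Gx; rewrite Ohm1_modular_p3 !inE Gx /= -order_dvdn => npx.
have := order_dvdG Gx; rewrite card_modular_p3 => /dvdn_pfactor -/(_ p_pr) [k k_le3 ox].
move: k_le3; rewrite leq_eqVlt => /orP [/eqP k3|].
  case/negP: nab; apply/cyclic_abelian/cyclicP; exists x; apply/eqP.
  by rewrite eq_sym eqEcard cycle_subG Gx -orderE ox k3 card_modular_p3 leqnn.
by case: k ox => [|[|[|k]]] // ox; case/negP: npx; rewrite ox.
Qed.

(* The Omega_1(G)-class of x fills the coset x Z(G), so the solutions y form a
   coset of the centralizer of x in Omega_1(G), which has order p. *)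
Lemma card_modular_p3_conjugators x : x \in G -> x \notin 'Ohm_1(G) ->
  #|[set y in 'Ohm_1(G) | x ^ y == x ^+ p.+1]| = p.
Proof.
have [x0 [y0 [_ _ _ _ [_ _ nab oZ [ZG' MhoZ oO]]]]] := modular_p3_structure.
move=> Gx Onx; set O := 'Ohm_1(G) in Onx oO *.
have sOG : O \subset G by apply: Ohm_sub.
have xpZ : x ^+ p \in 'Z(G).
  by rewrite -MhoZ -(expn1 p) Mho_p_elt // (mem_p_elt pG).
have ocl : (#|x ^: O| * #|'C_O[x]| = p ^ 2)%N.
  by rewrite -oO mulnC -index_cent1 Lagrange // subsetIl.
have clZ : x ^: O \subset x *: 'Z(G).
  apply/subsetP=> _ /imsetP [o Oo ->]; apply/lcosetP; exists [~ x, o].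
    by rewrite ZG' mem_commg // (subsetP sOG).
  by rewrite commgEl mulKVg.
(* If O centralized x, then C_G(x) would contain O and x, so it would have order p^3; x would be
   central, of order dividing p, and hence in O. *)
have cl1 : #|x ^: O| != 1%N.
  rewrite -index_cent1; apply/eqP => /eqP; rewrite indexg_eq1 subsetI subxx /= => sOC.
  have : (p ^ 2 < #|'C_G[x]|)%N.
    rewrite -oO; apply: proper_card; rewrite properE subsetI sOG sOC /=.
    by apply: contra Onx => /subsetP; apply; rewrite inE Gx cent1id.
  have := cardSg (subsetIl G 'C[x]); rewrite card_modular_p3.
  case/(dvdn_pfactor _ _ p_pr) => k k3 oC; rewrite oC ltn_exp2l // => k2.
  have {k2 k3} k3 : k = 3 by apply/eqP; rewrite eqn_leq k3.
  have CG : 'C_G[x] == G :> {set gT} by rewrite eqEcard subsetIl oC k3 card_modular_p3 /=.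
  have cGx : x \in 'C(G) by rewrite -sub_cent1 -{1}(eqP CG) subsetIr.
  have Zx : x \in 'Z(G) by rewrite inE Gx.
  case/negP: Onx; rewrite /O Ohm1_modular_p3 !inE Gx -order_dvdn /= -oZ.
  exact: order_dvdG.
(* The class size divides p^2 and is not 1, so it is at least p, the order of the center. *)
have clE : x ^: O = x *: 'Z(G).
  apply/eqP; rewrite eqEcard clZ card_lcoset oZ /=.
  have : (#|x ^: O| %| p ^ 2)%N by rewrite -ocl dvdn_mulr.
  case/(dvdn_pfactor _ _ p_pr) => -[|k] _ oC; first by rewrite oC eqxx in cl1.
  by rewrite oC expnS leq_pmulr // expn_gt0 ltnW.
(* Since x^p is central, x^(p+1) lies in x Z(G), which is the class of x under O. *)
have [o Oo xo] : exists2 o, o \in O & x ^+ p.+1 = x ^ o.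
  by apply/imsetP; rewrite -[imset _ _]/(x ^: O) clE expgS mem_lcoset mulKg.
have -> : [set y in O | x ^ y == x ^+ p.+1] = 'C_O[x] :* o.
  rewrite xo -astab1J -(amove_act 'J x (subsetT _) Oo).
  by apply/setP=> y; rewrite !inE.
rewrite card_rcoset; apply/eqP; rewrite -(eqn_pmul2l (ltnW p_gt1)).
by rewrite -{1}oZ -(card_lcoset 'Z(G) x) -clE ocl.
Qed.

Lemma card_Aut_modular_p3 : #|Aut G| = (p ^ 4 - p ^ 3)%N.
Proof.
have [x [y [Gx Gy ox oy [xy defG nab oZ [ZG' MhoZ oO]]]]] := modular_p3_structure.
(* The candidate images of [(x, y)]; [ev] maps [Aut G] bijectively onto [P]. *)
pose P := [set u in setX G G | (u.1 \notin 'Ohm_1(G)) &&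
              (u.2 \in [set v in 'Ohm_1(G) | u.1 ^ v == u.1 ^+ p.+1])].
have xX := cycle_id x; have yY := cycle_id y.
have sOG : 'Ohm_1(G) \subset G by apply: Ohm_sub.
pose ev (a : {perm gT}) := (a x, a y).
have cardP : #|P| = (p ^ 4 - p ^ 3)%N.
  transitivity ((\sum_(u in (G :\: 'Ohm_1(G))%g)
     \sum_(v in [set v in 'Ohm_1(G) | (u ^ v == u ^+ p.+1)%g]) 1)%N).
    rewrite pair_big_dep /= -sum1_card; apply: eq_bigl => -[u v].
    rewrite !inE /=; case: (boolP (v \in 'Ohm_1(G))) => [Ov|]; last by rewrite !andbF.
    by rewrite (subsetP sOG _ Ov) andbT andbCA andbA.
  rewrite (eq_bigr (fun _ => p)) => [|u /setDP [Gu nu]].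
    by rewrite sum_nat_const cardsD (setIidPr sOG) oO card_modular_p3 mulnBl -!expnSr.
  by rewrite sum1_card card_modular_p3_conjugators.
have Onx : x \notin 'Ohm_1(G).
  rewrite Ohm1_modular_p3 !inE Gx /= -order_dvdn ox -{2}(expn1 p).
  by rewrite dvdn_Pexp2l.
have Oy : y \in 'Ohm_1(G) by rewrite Ohm1_modular_p3 !inE Gy /= -oy expg_order.
have ev_inj : {in Aut G &, injective ev}.
  move=> a b Aa Ab [ex ey]; apply: (eq_Aut Aa Ab).
  have [_ <- _ _] := sdprodP defG.
  move=> _ /mulsgP [_ _ /cycleP [i ->] /cycleP [j ->] ->].
  rewrite -(autmE Aa) -(autmE Ab) !(morphM, morphX) ?groupX //=.
  by rewrite !autmE ex ey.
rewrite -cardP -(card_in_imset ev_inj); apply: eq_card => -[u v].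
apply/imsetP/idP => [[a Aa [-> ->]]|].
  rewrite !inE /= -(autmE Aa).
  have imG g : g \in G -> autm Aa g \in G.
    by move=> Gg; have := mem_morphim (autm_morphism Aa) Gg Gg; rewrite im_autm.
  (* Automorphisms preserve the condition g^p = 1, which defines Omega_1(G) here. *)
  have imO g : g \in G -> (autm Aa g \in 'Ohm_1(G)) = (g \in 'Ohm_1(G)).
    move=> Gg; rewrite !Ohm1_modular_p3 !inE Gg imG //= -morphX //.
    by rewrite (morph_injm_eq1 (injm_autm Aa)) ?groupX.
  rewrite !imO // Onx Oy !imG //=.
  by rewrite -morphJ // xy morphX.
rewrite !inE /= => /and3P [/andP [Gu Gv] nu /andP [Ov /eqP uv]].
have ou : #[u] = (p ^ 2)%N by apply: order_notin_Ohm1.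
have uv1 : u ^ v != u.
  by rewrite uv expgS -{3}(mulg1 u) (inj_eq (mulgI u)) -order_dvdn ou
    -{2}(expn1 p) dvdn_Pexp2l.
have ov : #[v] = p.
  have : (#[v] %| p)%N.
    by move: Ov; rewrite Ohm1_modular_p3 !inE Gv order_dvdn.
  case/primeP: p_pr => _ /[apply] /orP [|/eqP //].
  by rewrite order_eq1 => /eqP v1; rewrite v1 conjg1 eqxx in uv1.
have dx : #[u] %| #[x] by rewrite ou ox.
have dy : #[v] %| #[y] by rewrite ov oy.
(* This compatibility glues x -> u and y -> v into a morphism on the semidirect product. *)
have act : {in <[x]> & <[y]>, morph_act 'J 'J (eltm dx) (eltm dy)}.
  move=> _ _ /cycleP [i ->] /cycleP [j ->] /=.
  by rewrite conjXg (conj_expg _ xy) -expgM !eltmE conjXg (conj_expg _ uv) expgM.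
(* Since v has prime order, a nontrivial intersection would put v in [<[u]>], where it would commute
   with u. *)
have tiuv : <[u]> :&: <[v]> = 1.
  rewrite setIC; apply: prime_TIg; first by rewrite -orderE ov.
  rewrite cycle_subG; apply: contra uv1 => /cycleP [i ->].
  by rewrite conjgE -expgS expgSr mulKg.
pose f := sdprodm_morphism defG act.
have injf : 'injm f by rewrite injm_sdprodm !injm_eltm !im_eltm ou ox ov oy !dvdnn tiuv /=.
have imf : f @* G = G.
  apply/eqP; rewrite eqEcard card_injm // leqnn andbT.
  by rewrite im_sdprodm !im_eltm mul_subG ?cycle_subG.
exists (aut injf imf); first exact: Aut_aut.
by rewrite /ev !autE //= sdprodmEl // sdprodmEr //= !eltm_id.
Qed.
End ModularAut.

(** The element a has order p^2, so it generates a cyclic subgroup of index p; for odd p a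
    nonabelian p-group with such a subgroup is modular. *)
Lemma isog_modular_p3 (p : nat) (gT : finGroupType) (G : {group gT}) (a : gT) :
  prime p -> odd p -> #|G| = (p ^ 3)%N -> ~~ abelian G -> a \in G -> a ^+ p != 1 ->
  G \isog 'Mod_(p ^ 3).
Proof.
move=> p_pr p_odd oG nab Ga ap1; have p_gt1 := prime_gt1 p_pr.
have pG : p.-group G by rewrite /pgroup oG pnatX pnat_id.
have oa : #[a] = (p ^ 2)%N.
  have := order_dvdG Ga; rewrite oG => /dvdn_pfactor -/(_ p_pr) [k k_le3 oa].
  move: k_le3; rewrite leq_eqVlt => /orP [/eqP k3|].
    case/negP: nab; apply/cyclic_abelian/cyclicP; exists a; apply/eqP.
    by rewrite eq_sym eqEcard cycle_subG Ga -orderE oa k3 oG leqnn.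
  by case: k oa => [|[|[|k]]] // oa; rewrite -order_dvdn oa ?expn1 ?dvd1n ?dvdnn in ap1.
have iA : #|G : <[a]>| = p.
  rewrite -divgS ?cycle_subG // oG -orderE oa.
  by rewrite -(expnB (m := 3) (n := 2)) ?(ltnW p_gt1).
have := maximal_cycle_extremal pG nab (cycle_cyclic a) _ iA.
rewrite cycle_subG => /(_ Ga); have -> : (p == 2) = false.
  by apply/eqP => p2; move: p_odd; rewrite p2.
rewrite /= orbF => /eqP /modular_group_classP [q q_pr [n n_ge iso]].
have n_gt2 : (2 < n)%N by apply: leq_trans n_ge; rewrite leq_addl.
have := card_isog iso; rewrite card_modular_group // oG => e.
(* The classification returns some 'Mod_(q ^ n); comparing orders forces q = p and n = 3. *)
have pq : p = q.
  have : (p %| q ^ n)%N by rewrite -e dvdn_exp.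
  by rewrite Euclid_dvdX // dvdn_prime2 // => /andP [/eqP].
move: e; rewrite -pq in iso * => /eqP; rewrite eqn_exp2l // => /eqP n3.
by rewrite n3.
Qed.

(** * Regular permutation groups, their conjugacy and normalizers *)

Section Regular.
Variable T : finType.
Implicit Types (G H : {group {perm T}}) (s t : {perm T}).

(** Stated for sets, so that it applies to the entries of a tuple; for a group the second clause
    says that the action is free. *)
Definition regular (A : {set {perm T}}) :=
  (forall x y, exists2 g : {perm T}, g \in A & g x = y) /\
  (forall x, {in A &, injective (fun g : {perm T} => g x)}).

Lemma regularJ A s : regular A -> regular (A :^ s).
Proof.
case=> trA frA; split=> [x y|x _ _ /imsetP [g Ag ->] /imsetP [h Ah ->] /=].
  have [g Ag gx] := trA (s^-1 x) (s^-1 y).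
  by exists (g ^ s); rewrite ?memJ_conjg // !permM gx permKV.
by rewrite !permM => /perm_inj /(frA _ _ _ Ag Ah) ->.
Qed.

(** The points of T are labelled by G through g -> g x0 and by f(G) through h -> h y0; the required
    s is f read through these labels. *)
Lemma regular_conj_ext G (f : {morphism G >-> {perm T}}) (x0 y0 : T) :
  regular G -> regular (f @* G) -> 'injm f ->
  exists2 s : {perm T}, s x0 = y0 & {in G, forall g, g ^ s = f g}.
Proof.
move=> [trG frG] [trH frH] injf.
(* The label of x; by transitivity the default 1 is never reached. *)
pose g_ x := odflt 1 [pick g in G | g x0 == x].
have g_P x : g_ x \in G /\ g_ x x0 = x.
  rewrite /g_; case: pickP => [g /andP [Gg /eqP] //|no].
  by have [g Gg gx] := trG x0 x; have := no g; rewrite Gg gx eqxx.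
have g_u g : g \in G -> g_ (g x0) = g.
  by move=> Gg; have [Gh hx] := g_P (g x0); apply: (frG x0).
have s_inj : injective (fun x => f (g_ x) y0).
  move=> x x'; have [[Gg gx] [Gg' gx']] := (g_P x, g_P x').
  move=> /(frH _ _ _ (mem_morphim _ Gg Gg) (mem_morphim _ Gg' Gg')).
  by move=> /(injmP injf _ _ Gg Gg') e; rewrite -gx -gx' e.
exists (perm s_inj) => [|g Gg].
  by rewrite permE -{1}(perm1 x0) g_u // morph1 perm1.
apply/permP => y; rewrite -[y](permKV (perm s_inj)).
move: (_ y) => x; have [Gh hx] := g_P x.
rewrite -permM -conjgC permM !permE -{1}hx -permM g_u ?groupM //.
by rewrite morphM // permM.
Qed.

(** Every point is g x0 for some g in G, and s sends it to (g ^ s)(s x0). *)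
Lemma regular_conj_uniq G s t (x0 : T) : regular G -> s x0 = t x0 ->
  {in G, forall g, g ^ s = g ^ t} -> s = t.
Proof.
move=> [trG _] st gst; apply/permP=> x; have [g Gg <-] := trG x0 x.
by rewrite -!permM (conjgC g s) (conjgC g t) (permM s) (permM t) st gst.
Qed.

Lemma regular_isog_conj G H (x0 : T) : regular G -> regular H -> G \isog H ->
  exists s, G :^ s = H.
Proof.
move=> rG rH /isogP [f injf imf].
have rf : regular (f @* G) by rewrite imf.
have [s _ fs] := regular_conj_ext x0 x0 rG rf injf.
exists s; rewrite -imf morphimEdom.
by apply: eq_in_imset.
Qed.

Lemma card_norm_regular G (x0 : T) : regular G ->
  #|'N(G)| = (#|T| * #|Aut G|)%N.
Proof.
move=> rG; pose ev (s : {perm T}) := (s x0, conj_aut G s).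
have conjA s : s \in 'N(G) -> conj_aut G s \in Aut G.
  by move=> Ns; apply: (subsetP (Aut_conj_aut G 'N(G))); apply: mem_morphim.
have ev_inj : {in 'N(G) &, injective ev}.
  move=> s t Ns Nt [sx st]; apply: (regular_conj_uniq rG sx) => g Gg.
  by rewrite -(norm_conj_autE Ns Gg) -(norm_conj_autE Nt Gg) st.
rewrite -(card_in_imset ev_inj) -cardsT -cardsX; apply: eq_card => -[y a].
rewrite in_setX in_setT /=; apply/imsetP/idP => [[s Ns [_ ->]]|Aa].
  exact: conjA.
(* Surjectivity of [ev]: the automorphism a and the target y are realized together by one
   conjugating permutation. *)
have rA : regular (autm_morphism Aa @* G) by rewrite im_autm.
have [s sx sa] := regular_conj_ext x0 y rG rA (injm_autm Aa).
have Ns : s \in 'N(G).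
  rewrite inE; apply/subsetP=> _ /imsetP [g Gg ->].
  by rewrite sa //= autmE; have := Aut_closed Aa Gg.
exists s => //; rewrite /ev sx; congr pair.
apply: (eq_Aut Aa (conjA _ Ns)) => g Gg.
by rewrite (norm_conj_autE Ns Gg) sa //= autmE.
Qed.

Lemma card_conjugates_regular G (x0 : T) : regular G ->
  (#|G :^: [set: {perm T}]| * (#|T| * #|Aut G|))%N = #|T|`!.
Proof.
move=> rG; rewrite card_conjugates setTI -(card_norm_regular x0 rG) mulnC.
rewrite Lagrange ?subsetT // cardsT.
rewrite -[#|T| in RHS]cardsT -card_perm; apply: eq_card => s.
by rewrite !inE; apply/esym/subsetP => x; rewrite inE.
Qed.
End Regular.

(** * Reduced polynomials as functions on F x F *)

Section ReducedPolynomials.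
Local Open Scope ring_scope.
Variable F : finFieldType.
Local Notation q := #|F|.
Implicit Types (f g : {mpoly F[2]}) (a b : {ffun 'I_q * 'I_q -> F}).

(** A polynomial of degree below q with q roots is zero. *)
Lemma vanishing_poly_coef0 (E : nat -> F) :
  (forall x, \sum_(i < q) E i * x ^+ i = 0) -> forall i : 'I_q, E i = 0.
Proof.
move=> E0 i; transitivity (\poly_(i < q) E i)`_i; first by rewrite coef_poly ltn_ord.
suff -> : \poly_(i < q) E i = 0 by rewrite coef0.
apply: (roots_geq_poly_eq0 (rs := enum F)); rewrite ?enum_uniq //.
  by apply/allP => x _; rewrite /root horner_poly E0.
by rewrite -cardE size_poly.
Qed.

Definition exponent_pair (u : 'I_q * 'I_q) : 'X_{1..2} :=
  [multinom (if val k == 0 then u.1 : nat else u.2) | k < 2].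

Lemma exponent_pair_inj : injective exponent_pair.
Proof.
move=> [i j] [i' j'] e; congr pair; apply: val_inj.
  by have := congr1 (fun m : 'X_{1..2} => m 0) e; rewrite !mnmE.
by have := congr1 (fun m : 'X_{1..2} => m 1) e; rewrite !mnmE.
Qed.

Definition poly_of_coef a : {mpoly F[2]} :=
  \sum_u a u *: 'X_[exponent_pair u].

Lemma eval2_poly_of_coef a x y :
  eval2 (poly_of_coef a) x y = \sum_i \sum_j a (i, j) * (x ^+ i * y ^+ j).
Proof.
rewrite pair_bigA /= /eval2 raddf_sum; apply: eq_bigr => -[i j] _ /=.
by rewrite mevalZ mevalX big_ord_recl big_ord1 !mnmE.
Qed.

Lemma mcoeff_poly_of_coef a u : (poly_of_coef a)@_(exponent_pair u) = a u.
Proof.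
rewrite raddf_sum (bigD1 u) //= mcoeffZ mcoeffX eqxx mulr1 big1 ?addr0 // => v vu.
by rewrite mcoeffZ mcoeffX (inj_eq exponent_pair_inj) (negPf vu) mulr0.
Qed.

Lemma msupp_poly_of_coef a m : m \in msupp (poly_of_coef a) ->
  exists u, m = exponent_pair u.
Proof.
rewrite mcoeff_msupp raddf_sum /= => nz.
case: (pickP (fun u => exponent_pair u == m)) => [u /eqP <-|no]; first by exists u.
case/eqP: nz; apply: big1 => u _.
by rewrite mcoeffZ mcoeffX no mulr0.
Qed.

Lemma reduced_poly_of_coef a : reduced (poly_of_coef a).
Proof. by move=> m /msupp_poly_of_coef [u ->] i; rewrite mnmE; case: ifP. Qed.

Lemma reduced_coef f : reduced f -> exists a, f = poly_of_coef a.
Proof.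
move=> rf; exists [ffun u => f@_(exponent_pair u)]; apply/mpolyP => m.
case: (pickP (fun u => exponent_pair u == m)) => [u /eqP <-|no].
  by rewrite mcoeff_poly_of_coef ffunE.
have /eqP -> : f@_m == 0.
  rewrite mcoeff_eq0; apply/negP => /rf lt.
  have /eqP [] := no (Ordinal (lt 0), Ordinal (lt 1)).
  apply/mnmP => i; rewrite mnmE /=.
  case: i => [[|[|i]]] //= lti; rewrite ?inE; congr (m _); exact/val_inj.
apply/esym/eqP; rewrite mcoeff_eq0; apply/negP => /msupp_poly_of_coef [u mu].
by have := no u; rewrite mu eqxx.
Qed.

Definition coef_eval a : {ffun F * F -> F} :=
  [ffun xy => eval2 (poly_of_coef a) xy.1 xy.2].

(** The one-variable fact is used twice: for each fixed y the coefficients of powers of x vanish,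
    and these are polynomials in y. *)
Lemma coef_eval_inj : injective coef_eval.
Proof.
move=> a b ab; apply/ffunP => -[i j]; move: (i : 'I_q) (j : 'I_q) => {}i {}j.
apply/eqP; rewrite -subr_eq0; apply/eqP.
(* [E] and [E'] extend by 0 to all naturals the coefficients in x at a given y, and the coefficients
   in y of x^i. *)
pose E (y : F) (k : nat) := if insub k : option 'I_q is Some k' then
  \sum_(l < q) (a (k', l) - b (k', l)) * y ^+ l else 0.
pose E' (k : nat) := if insub k : option 'I_q is Some k' then (a (i, k') - b (i, k')) else 0.
suff E'0 : forall k : 'I_q, E' k = 0 by have := E'0 j; rewrite /E' valK.
apply: vanishing_poly_coef0 => y; transitivity (E y i).
  by rewrite /E valK; apply: eq_bigr => l _; rewrite /E' valK.
apply: vanishing_poly_coef0 => x.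
have := congr1 (fun h : {ffun F * F -> F} => h (x, y)) ab.
rewrite !ffunE !eval2_poly_of_coef /= => /eqP; rewrite -subr_eq0 => /eqP e0.
rewrite -[RHS]e0 -sumrB; apply: eq_bigr => k _; rewrite /E valK big_distrl -sumrB /=.
by apply: eq_bigr => l _; rewrite -mulrA (mulrC (y ^+ l)) mulrBl.
Qed.

(** Coefficient tables and functions are equally numerous, so the injective evaluation map is
    onto. *)
Lemma reduced_interpolation (h : F -> F -> F) :
  exists2 f, reduced f & forall x y, eval2 f x y = h x y.
Proof.
have [|g _ gK] := inj_card_bij coef_eval_inj.
  by rewrite !card_ffun !card_prod card_ord.
exists (poly_of_coef (g [ffun u => h u.1 u.2])); first exact: reduced_poly_of_coef.
by move=> x y; have /ffunP /(_ (x, y)) := gK [ffun u => h u.1 u.2]; rewrite !ffunE.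
Qed.

Lemma reduced_eval2_inj f g : reduced f -> reduced g ->
  (forall x y, eval2 f x y = eval2 g x y) -> f = g.
Proof.
move=> /reduced_coef [a ->] /reduced_coef [b ->] ab; congr poly_of_coef.
by apply: coef_eval_inj; apply/ffunP => -[x y]; rewrite !ffunE.
Qed.
End ReducedPolynomials.

(** * Powers of cycles and products of disjoint cycles *)

Section CyclePerm.
Local Open Scope nat_scope.
Variable T : finType.
Implicit Types (s : seq T) (x : T).

Lemma cycle_perm_out s x : x \notin s -> cycle_perm s x = x.
Proof. by move=> sx; rewrite permE next_nth mem_undup (negPf sx). Qed.

Lemma cycle_perm_nth x0 s i : uniq s -> i.+1 < size s ->
  cycle_perm s (nth x0 s i) = nth x0 s i.+1.
Proof.
move=> us lt; rewrite permE undup_id // next_nth mem_nth; last exact: ltnW.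
rewrite index_uniq //; last exact: ltnW.
by case: s us lt => //= y s _ lt; apply: set_nth_default.
Qed.

Lemma cycle_perm_expg_nth x0 s i k : uniq s -> i + k < size s ->
  (cycle_perm s ^+ k)%g (nth x0 s i) = nth x0 s (i + k).
Proof.
move=> us; elim: k => [|k IHk] lt; first by rewrite addn0 perm1.
rewrite addnS in lt *; rewrite expgSr permM IHk; last exact: ltnW.
exact: cycle_perm_nth.
Qed.

Lemma expg_fix (s : {perm T}) x k : s x = x -> (s ^+ k)%g x = x.
Proof. by move=> sx; elim: k => [|k IHk]; rewrite ?perm1 // expgS permM sx. Qed.

(** Factors before i fix x and factors after i fix its image, whatever the order of enumeration. *)
Lemma prod_perm_single (I : finType) (s : I -> {perm T}) i x :
  (forall j, j != i -> s j x = x) -> (forall j, j != i -> s j (s i x) = s i x) ->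
  (\prod_j s j)%g x = s i x.
Proof.
move=> fx fsx; have fix_seq r : i \notin r -> (\prod_(j <- r) s j)%g (s i x) = s i x.
  elim: r => [|j r IHr]; first by rewrite big_nil perm1.
  by rewrite inE big_cons permM eq_sym => /norP [/fsx -> /IHr].
have := index_enum_uniq I; have := mem_index_enum i.
elim: (index_enum I) => [//|j r IHr]; rewrite big_cons permM inE /=.
have [<- _ /andP [ir _]|ij /= ir /andP [_ ur]] := eqVneq i j; first exact: fix_seq.
by rewrite fx ?IHr // eq_sym.
Qed.
End CyclePerm.

(** * Values of the generators a and b; a^p is not 1 and ab differs from ba *)

Section GeneratorValues.
Local Open Scope nat_scope.

(** Turns the double enumeration in [cycle_b] into a single position t, with the two indices as
    quotient and remainder. *)
Lemma allpairs_iota (T : Type) (f : nat -> nat -> T) m n :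
  [seq f j i | j <- iota 0 m, i <- iota 0 n] =
  [seq f (t %/ n) (t %% n) | t <- iota 0 (m * n)].
Proof.
elim: m => [|m IHm] //.
rewrite -addn1 iotaD allpairs_cat IHm mulnDl mul1n iotaD map_cat; congr cat.
rewrite /= cats0 !add0n -(addn0 (m * n)) iotaDl -map_comp.
apply/eq_in_map => i; rewrite mem_iota add0n => /andP [_ lt] /=.
by rewrite divnMDl ?modnMDl ?divn_small ?modn_small ?addn0 //; lia.
Qed.

Variables (F : finFieldType) (p : nat) (c : (p ^ 3).-tuple F).
Hypotheses (p_gt1 : 1 < p) (c_uniq : uniq c).
Local Notation pt n := (nth 0%R c n).

Lemma pt_inj m n : m < p ^ 3 -> n < p ^ 3 -> pt m = pt n -> m = n.
Proof. by move=> lm ln /eqP; rewrite nth_uniq ?size_tuple // => /eqP. Qed.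

Lemma perm_a_pt m j : m < p -> j.+1 < p ^ 2 ->
  perm_a p c (pt (m * p ^ 2 + j)) = pt (m * p ^ 2 + j.+1).
Proof.
move=> lm lj.
have bound m' j' : m' < p -> j' < p ^ 2 -> m' * p ^ 2 + j' < p ^ 3.
  by move=> lm' lj'; rewrite (expnS p 2); nia.
have seqE m' : m' < p -> uniq [seq pt (m' * p ^ 2 + j) | j <- iota 0 (p ^ 2)].
  move=> lm'; rewrite map_inj_in_uniq ?iota_uniq // => i j'.
  rewrite !mem_iota /= !add0n => li lj' /pt_inj e.
  by have := e (bound _ _ lm' li) (bound _ _ lm' lj'); lia.
have out (m' : 'I_p) j' : j' < p ^ 2 -> m' != Ordinal lm ->
    cycle_a p c m' (pt (m * p ^ 2 + j')) = pt (m * p ^ 2 + j').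
  (* The quotient of an index by p^2 tells which cycle of a contains the point. *)
  move=> lj' ne; apply: cycle_perm_out; apply/mapP => -[i]; rewrite mem_iota /= => li.
  move=> /pt_inj e; have {e} e := e (bound _ _ lm lj') (bound _ _ (ltn_ord m') li).
  have := congr1 (divn^~ (p ^ 2)) e; rewrite !divnMDl ?expn_gt0 1?ltnW //.
  rewrite !divn_small // !addn0 => mm; case/eqP: ne; exact: val_inj.
have step : cycle_a p c (Ordinal lm) (pt (m * p ^ 2 + j)) = pt (m * p ^ 2 + j.+1).
  have := @cycle_perm_nth _ 0%R _ j (seqE _ lm).
  by rewrite size_map size_iota => /(_ lj); rewrite !(nth_map 0) ?size_iota ?nth_iota // ltnW.
rewrite /perm_a (@prod_perm_single _ _ _ (Ordinal lm)) ?step // => m' ne.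
  by apply: out => //; apply: ltnW.
exact: out.
Qed.

(* The entry of position t in the cycle b_k is c_(b_index k t). *)
Definition b_index k t := t %/ p * p + t %% p * p ^ 2 + k.

(** The exponent of b_k advances the position by 1 + k p; the bound on t avoids wrapping around the
    cycle. *)
Lemma perm_b_pt k t : k < p -> t + (1 + k * p) < p ^ 2 ->
  perm_b p c (pt (b_index k t)) = pt (b_index k (t + (1 + k * p))).
Proof.
move=> lk lt.
have p_gt0 : 0 < p by apply: ltnW.
have bound k' t' : k' < p -> t' < p ^ 2 -> b_index k' t' < p ^ 3.
  move=> lk' lt'; rewrite /b_index.
  have : t' %/ p < p by rewrite ltn_divLR // mulnn.
  have := ltn_pmod t' p_gt0; rewrite (expnS p 2) (expnS p 1) expn1; nia.
(* The residue of an index mod p tells which cycle b_k contains the point. *)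
have modE k' t' : k' < p -> b_index k' t' %% p = k'.
  by move=> lk'; rewrite /b_index -mulnn mulnA -mulnDl modnMDl modn_small.
(* [b_index] exchanges the two base-p digits of t, and these digits determine t. *)
have inj k' t1 t2 : k' < p -> t1 < p ^ 2 -> t2 < p ^ 2 ->
    b_index k' t1 = b_index k' t2 -> t1 = t2.
  move=> lk' l1 l2 /addIn e.
  have l1' : t1 %/ p < p by rewrite ltn_divLR // mulnn.
  have l2' : t2 %/ p < p by rewrite ltn_divLR // mulnn.
  move/eqP: e; rewrite -!mulnn !mulnA -!mulnDl eqn_pmul2r // => /eqP e.
  have em : t1 %% p = t2 %% p.
    have := congr1 (divn^~ p) e; rewrite !(addnC (_ %/ _)) !divnMDl //.
    by rewrite !(divn_small l1', divn_small l2') !addn0.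
  have ed : t1 %/ p = t2 %/ p by move: e; rewrite em => /addIn.
  by rewrite (divn_eq t1 p) (divn_eq t2 p) em ed.
have cycE k' : cycle_b p c k' = cycle_perm [seq pt (b_index k' t) | t <- iota 0 (p * p)].
  rewrite /cycle_b; congr cycle_perm.
  exact: (allpairs_iota (fun j i => pt (j * p + i * p ^ 2 + k'))).
have seq_uniq : uniq [seq pt (b_index k t) | t <- iota 0 (p * p)].
  rewrite map_inj_in_uniq ?iota_uniq // => i j'.
  rewrite !mem_iota /= !add0n mulnn => li lj' /pt_inj e.
  by apply: (inj k) => //; apply: e; apply: bound.
have out (k' : 'I_p) t' : t' < p ^ 2 -> k' != Ordinal lk ->
    (cycle_b p c k' ^+ (1 + k' * p))%g (pt (b_index k t')) = pt (b_index k t').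
  move=> lt' ne; apply: expg_fix; rewrite cycE; apply: cycle_perm_out.
  apply/mapP => -[i]; rewrite mem_iota /= add0n mulnn => li.
  move=> /pt_inj e; have {e} e := e (bound _ _ lk lt') (bound _ _ (ltn_ord k') li).
  have := congr1 (modn^~ p) e; rewrite !modE // => kk; case/eqP: ne; exact: val_inj.
have step : (cycle_b p c (Ordinal lk) ^+ (1 + Ordinal lk * p))%g (pt (b_index k t))
    = pt (b_index k (t + (1 + k * p))).
  rewrite cycE /=; have := @cycle_perm_expg_nth _ 0%R _ t (1 + k * p) seq_uniq.
  rewrite size_map size_iota mulnn => /(_ lt).
  have lt0 : t < p ^ 2 by apply: leq_ltn_trans lt; apply: leq_addr.
  by rewrite !(nth_map 0) ?size_iota ?mulnn // !nth_iota.
rewrite /perm_b (@prod_perm_single _ _ _ (Ordinal lk)) ?step // => k' ne.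
  by apply: out => //; apply: leq_ltn_trans lt; apply: leq_addr.
exact: out.
Qed.

(** The power a^p sends c_0 to c_p, since p < p^2 leaves no wrap-around. *)
Lemma perm_a_expg_neq1 : (perm_a p c ^+ p)%g != 1%g.
Proof.
have ak k : k < p ^ 2 -> (perm_a p c ^+ k)%g (pt 0) = pt k.
  elim: k => [|k IHk] lk; first by rewrite perm1.
  rewrite expgSr permM IHk 1?ltnW //.
  by have := @perm_a_pt 0 k (ltnW p_gt1) lk; rewrite mul0n.
apply/eqP => /(congr1 (fun s : {perm F} => s (pt 0))).
have lp : p < p ^ 2 by nia.
rewrite ak // perm1 => /pt_inj e; have := e _ _; rewrite (expnS p 2) => e'.
have : p = 0 by apply: e'; nia.
lia.
Qed.

(** At c_0, a followed by b gives the index p + p^2 + 1, through the exponent 1 + p of b_1, while b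
    followed by a gives p^2 + 1. *)
Lemma perm_ab_neq : (perm_a p c * perm_b p c != perm_b p c * perm_a p c)%g.
Proof.
apply/eqP => /(congr1 (fun s : {perm F} => s (pt 0))); rewrite !permM.
have lp2 : p.+1 < p ^ 2 by nia.
have := @perm_a_pt 0 0 (ltnW p_gt1); rewrite !mul0n => -> //; last by lia.
have := @perm_a_pt 1 0 p_gt1; rewrite mul1n addn0 => a1.
have b0 : perm_b p c (pt 0) = pt (p ^ 2).
  have := @perm_b_pt 0 0 (ltnW p_gt1); rewrite /b_index div0n mod0n mul0n !addn0.
  by rewrite divn_small // modn_small // mul1n => -> //; lia.
have b1 : perm_b p c (pt 1) = pt (p + p ^ 2 + 1).
  have := @perm_b_pt 1 0 p_gt1; rewrite /b_index div0n mod0n !mul0n !add0n.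
  rewrite addnC divnMDl ?modnMDl ?(ltnW p_gt1) // divn_small // modn_small // !mul1n.
  by move=> -> //; lia.
rewrite b0 b1 a1; last by lia.
move=> /pt_inj e; have : p + p ^ 2 + 1 = p ^ 2 + 1.
  by apply: e; rewrite (expnS p 2); nia.
lia.
Qed.
End GeneratorValues.

(** * Permutation group polynomials as enumerations of regular subgroups *)

Section Correspondence.
Variables (F : finFieldType) (n : nat) (c : n.-tuple F).
Hypotheses (oF : #|F| = n) (c_uniq : uniq c).
Implicit Types (f g : {mpoly F[2]}) (G H : {group {perm F}}).

Lemma tnth_enum_inj : injective (tnth c).
Proof. exact/tuple_uniqP. Qed.

Lemma tnth_enum_surj y : exists i, tnth c i = y.
Proof.
have [|d _ dK] := inj_card_bij tnth_enum_inj; first by rewrite oF card_ord.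
by exists (d y).
Qed.

Lemma perm_tuple_val_inj f (beta : 'I_n -> {perm F}) x : perm_tuple_of c f beta ->
  injective (fun i => beta i x).
Proof.
move=> fb i j /= e; apply: tnth_enum_inj.
by rewrite -(fb i x) -(fb j x) e.
Qed.

Lemma perm_tuple_inj f (beta : 'I_n -> {perm F}) : perm_tuple_of c f beta ->
  injective beta.
Proof. by move=> fb i j e; apply: (perm_tuple_val_inj (x := 0%R) fb); rewrite e. Qed.

Lemma perm_tuple_unique f (beta beta' : 'I_n -> {perm F}) : lpp f ->
  perm_tuple_of c f beta -> perm_tuple_of c f beta' -> beta =1 beta'.
Proof.
move=> [_ /= ff] fb fb' i; apply/permP => x.
by apply: (bij_inj (ff x).2); rewrite fb fb'.
Qed.

Lemma corresponds_unique f G H :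
  corresponds_to c f G -> corresponds_to c f H -> G = H.
Proof.
move=> [lf [b fb bG]] [_ [b' fb' bH]]; apply: val_inj; rewrite /= -bG -bH.
by apply: eq_imset; apply: perm_tuple_unique lf fb fb'.
Qed.

Lemma corresponds_regular f G : corresponds_to c f G -> regular G.
Proof.
move=> [[_ lf] [b fb bG]]; split=> [x y|x g h].
  have [i ci] := tnth_enum_surj (eval2 f x y).
  exists (b i); first by rewrite -bG imset_f.
  by apply: (bij_inj (lf x).2); rewrite fb.
rewrite -bG => /imsetP [i _ ->] /imsetP [j _ ->] /= e.
by rewrite (perm_tuple_val_inj fb e).
Qed.

Lemma corresponds_card f G : corresponds_to c f G -> #|G| = n.
Proof.
by move=> [_ [b fb <-]]; rewrite card_imset ?card_ord //; apply: perm_tuple_inj fb.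
Qed.

(** Interpolate the function sending (x, y) to c_i for the unique i with beta_i(x) = y. *)
Lemma lpp_of_regular (beta : 'I_n -> {perm F}) : injective beta ->
  regular [set beta i | i : 'I_n] -> exists2 f, lpp f & perm_tuple_of c f beta.
Proof.
move=> b_inj [trb frb].
have b_ex x y : exists i, beta i x == y.
  by have [_ /imsetP [i _ ->] e] := trb x y; exists i; rewrite e.
pose idx x y := xchoose (b_ex x y).
have idxP x y : beta (idx x y) x = y by apply/eqP; apply: (xchooseP (b_ex x y)).
have [f rf fE] := reduced_interpolation (fun x y => tnth c (idx x y)).
exists f; last first.
  move=> i x; rewrite fE; congr tnth; apply: b_inj.
  by apply: (frb x); rewrite ?imset_f //= idxP.
(* On a finite field injectivity suffices: equal values mean equal indices, hence the same
   permutation. *)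
split=> // z; split; apply: injF_bij => x y; rewrite !fE => /tnth_enum_inj e.
  by apply: (@perm_inj _ (beta (idx x z))); rewrite {2}e !idxP.
by rewrite -(idxP z x) e idxP.
Qed.

(** By transitivity every point of the plane is some (x, beta_i(x)), where the tuple prescribes the
    value. *)
Lemma lpp_unique f g (beta : 'I_n -> {perm F}) :
  lpp f -> lpp g -> perm_tuple_of c f beta -> perm_tuple_of c g beta ->
  regular [set beta i | i : 'I_n] -> f = g.
Proof.
move=> [rf _] [rg _] fb gb [trb _]; apply: reduced_eval2_inj => // x y.
by have [_ /imsetP [i _ ->] <-] := trb x y; rewrite fb gb.
Qed.

(** Group the injections by image: each set of size |D| is the image of |D|! of them. *)
Lemma card_ffun_onto_sets (D T : finType) (C : {set {set T}}) :
  {in C, forall A : {set T}, #|A| = #|D|} ->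
  #|[set b : {ffun D -> T} | injectiveb b && ([set b i | i : D] \in C)]|
    = (#|D|`! * #|C|)%N.
Proof.
move=> oC; rewrite -sum1dep_card.
rewrite (partition_big (fun b : {ffun D -> T} => [set b i | i : D]) (mem C)) /=; last first.
  by move=> b /andP [].
rewrite mulnC -sum_nat_const; apply: eq_bigr => A CA; rewrite sum1dep_card.
rewrite -[RHS]ffactnn -{1}(oC A CA) -card_inj_ffuns_on; apply: eq_card => b.
rewrite !inE; apply/andP/andP => [[/andP [ib _] /eqP <-]|[/ffun_onP bA ib]].
  by split=> //; apply/ffun_onP => i; rewrite imset_f.
suff /eqP -> : [set b i | i : D] == A by rewrite ib CA.
rewrite eqEcard card_imset ?oC ?leqnn ?andbT //; last exact/injectiveP.
by apply/subsetP => _ /imsetP [i _ ->].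
Qed.

(** The polynomials counted are in bijection with the injective enumerations of the conjugates of G,
    n! for each conjugate. *)
Lemma has_card_same_form f G : corresponds_to c f G ->
  has_card (fun g => perm_group_poly c g /\ same_form c g f)
    (n`! * #|G :^: [set: {perm F}]|)%N.
Proof.
move=> fG; have rG := corresponds_regular fG.
pose B := [set b : {ffun 'I_n -> {perm F}} |
  injectiveb b && ([set b i | i : 'I_n] \in G :^: [set: {perm F}])].
have B_reg b : b \in B -> injective b /\
    exists s, [set b i | i : 'I_n] = G :^ s :> {set {perm F}}.
  by rewrite inE => /andP [/injectiveP ib /imsetP [s _ bs]]; split; last exists s.
(* The membership hypothesis sits under the existential so that a total choice function exists;
   outside [B] its value is the dummy 0. *)
have phi_ex b : exists g, b \in B -> lpp g /\ perm_tuple_of c g b.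
  have [/B_reg [ib [s bs]]|_] := boolP (b \in B); last by exists 0%R.
  by have [|g lg gb] := lpp_of_regular ib; [rewrite bs; apply: regularJ | exists g].
have [phi phiP] := fin_all_exists phi_ex.
exists [seq phi b | b <- enum B]; split.
- rewrite map_inj_in_uniq ?enum_uniq // => b b'; rewrite !mem_enum.
  move=> /phiP [lb pb] /phiP [_ pb'] e; apply/ffunP.
  by apply: perm_tuple_unique lb pb _; rewrite e.
- move=> g; split.
    case/mapP => b; rewrite mem_enum => Bb ->.
    have [lg gb] := phiP b Bb; have [_ [s bs]] := B_reg b Bb.
    have gGs : corresponds_to c (phi b) (G :^ s)%G by split=> //; exists b.
    split; first by exists (G :^ s)%G.
    by exists (G :^ s)%G, G; split=> //; rewrite isog_sym conj_isog.
  move=> [_ [H [K [gH fK isoHK]]]]; rewrite (corresponds_unique fK fG) in isoHK.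
  have rH := corresponds_regular gH.
  have [s sH] : exists s, G :^ s = H.
    by apply: regular_isog_conj 0%R rG rH _; rewrite isog_sym.
  have [lg [b gb bH]] := gH; pose b' := finfun b.
  have b'H : [set b' i | i : 'I_n] = H :> {set {perm F}}.
    by rewrite -bH; apply: eq_imset => i; rewrite ffunE.
  have gb' : perm_tuple_of c g b' by move=> i x; rewrite ffunE.
  have Bb' : b' \in B.
    rewrite inE b'H -sH; apply/andP; split; last by apply: imset_f; rewrite inE.
    by apply/injectiveP; apply: perm_tuple_inj gb'.
  apply/mapP; exists b'; first by rewrite mem_enum.
  have [lp pb] := phiP b' Bb'; apply: lpp_unique lg lp gb' pb _.
  by rewrite b'H.
rewrite size_map -cardE card_ffun_onto_sets card_ord // => _ /imsetP [s _ ->].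
by rewrite cardJg (corresponds_card fG).
Qed.
End Correspondence.

(** * The count for G *)

Local Open Scope ring_scope.

Theorem theorem4p6 (p : nat) (hp : prime p) (hodd : odd p)
    (F : finFieldType) (hF : #|F| = (p ^ 3)%N)
    (c : (p ^ 3).-tuple F) (hc : uniq c)
    (f : {mpoly F[2]}) (hf : corresponds_to c f (groupG p c)) :
  exists2 Pf : nat,
    has_card (fun g : {mpoly F[2]} => perm_group_poly c g /\ same_form c g f) Pf &
    Pf%:R = ((p ^ 3)`!)%:R ^+ 2
            / (p%:R ^+ 3 * (p%:R ^+ 4 - p%:R ^+ 3)) :> rat.
Proof.
have [p_gt1 p_gt0] := (prime_gt1 hp, prime_gt0 hp).
set G := groupG p c in hf *.
have rG := corresponds_regular hF hc hf.
have [Ga Gb] : perm_a p c \in G /\ perm_b p c \in G.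
  by split; apply: mem_gen; rewrite !inE eqxx ?orbT.
have isoG : (G \isog 'Mod_(p ^ 3))%g.
  apply: (isog_modular_p3 hp hodd (corresponds_card hc hf) _ Ga (perm_a_expg_neq1 p_gt1 hc)).
  apply/negP => /centsP /(_ _ Ga _ Gb) /eqP.
  exact/negP/(perm_ab_neq p_gt1 hc).
(* The number of conjugates times p^3 (p^4 - p^3) equals (p^3)!. *)
have cardE := card_conjugates_regular (0 : F) rG.
rewrite hF (card_Aut_modular_p3 hp hodd isoG) in cardE.
exists ((p ^ 3)`! * #|G :^: [set: {perm F}]|)%N.
  exact: (has_card_same_form hF hc hf).
(* A nonzero denominator lets the rational identity be cleared to one in the naturals; p^3 <= p^4
   makes truncated subtraction exact. *)
have nz : (p%:R ^+ 3 * (p%:R ^+ 4 - p%:R ^+ 3)) != 0 :> rat.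
  by rewrite -!natrX -natrB ?leq_exp2l // -natrM Num.Theory.pnatr_eq0 -lt0n muln_gt0
    expn_gt0 p_gt0 subn_gt0 ltn_exp2l ?p_gt1.
apply: (mulIf nz); rewrite divfK // -!natrX -natrB ?leq_exp2l // -!natrM.
by congr _%:R; rewrite -mulnA cardE mulnn.
Qed.
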